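(* For every integer $n\ge 51$, $$nW(ne)-2n+\frac{n}{W(ne)}+\frac{W(ne)}{n}<\ln \phi(n+1)<nW(ne)-2n+\frac{n}{W(ne)}+\frac{W(ne)}{n}+\frac{\ln\ln (ne)}{n}.$$
   Context: $W$ is the Lambert W-function: for $y>0$, $W(y)>0$ is defined by $W(y)e^{W(y)}=y$. For an integer $m\ge2$, $\phi(m)=\sup_{1<x<m}\frac{x^{m-x}-1}{x-1}$ (supremum over real $x$). *)

(* Defs.v *)
From Stdlib Require Import Reals Lra Lia ClassicalEpsilon.
From Coquelicot Require Import Coquelicot.
Open Scope R_scope.

(* The principal branch of the Lambert function on the positive reals; the
   value at y <= 0 is unspecified. *)
Definition LambertW (y : R) : R :=
  epsilon (inhabits 0) (fun w : R => 0 < w /\ w * exp w = y).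

Definition phi_set (m : nat) (v : R) : Prop :=
  exists x : R, 1 < x < INR m /\ v = (Rpower x (INR m - x) - 1) / (x - 1).

(* [real] sends infinite bounds to 0; [phi_is_lub] shows that this does not
   happen for m >= 2. *)
Definition phi (m : nat) : R := real (Lub_Rbar (phi_set m)).

Lemma LambertW_exists (y : R) : 0 < y -> exists w : R, 0 < w /\ w * exp w = y.
Proof.
intros Hy.
assert (Hexp : 1 < exp y).
{ pose proof (exp_ineq1 y). lra. }
destruct (IVT (fun w => w * exp w - y) 0 y) as [z [Hz1 Hz2]].
- intros x.
  apply derivable_continuous_pt.
  exists (1 * exp x + x * exp x - 0).
  apply derivable_pt_lim_minus.
  + apply derivable_pt_lim_mult.
    * apply derivable_pt_lim_id.
    * apply derivable_pt_lim_exp.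
  + apply derivable_pt_lim_const.
- exact Hy.
- lra.
- nra.
- exists z. split; [| lra].
  destruct (Req_dec z 0) as [-> |]; lra.
Qed.

Lemma LambertW_spec (y : R) :
  0 < y -> 0 < LambertW y /\ LambertW y * exp (LambertW y) = y.
Proof.
intros Hy. unfold LambertW. apply epsilon_spec. now apply LambertW_exists.
Qed.

Lemma LambertW_unique (y w : R) : 0 < w -> w * exp w = y -> LambertW y = w.
Proof.
intros Hw Hy.
assert (Hy0 : 0 < y) by (rewrite <- Hy; pose proof (exp_pos w); nra).
destruct (LambertW_spec y Hy0) as [H1 H2].
set (u := LambertW y) in *.
pose proof (exp_pos u). pose proof (exp_pos w).
destruct (Rtotal_order u w) as [Hlt | [Heq | Hgt]]; [| exact Heq |].
- exfalso. pose proof (exp_increasing _ _ Hlt).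
  assert (u * exp u < w * exp w) by (apply Rmult_gt_0_lt_compat; lra). lra.
- exfalso. pose proof (exp_increasing _ _ Hgt).
  assert (w * exp w < u * exp u) by (apply Rmult_gt_0_lt_compat; lra). lra.
Qed.

Lemma pow_sub1_le (x : R) (k : nat) :
  1 < x -> x ^ k - 1 <= INR k * x ^ k * (x - 1).
Proof.
intros Hx. induction k as [| k IH].
- simpl. lra.
- rewrite S_INR. simpl.
  assert (1 <= x ^ k) by (apply pow_R1_Rle; lra).
  assert (x * (x ^ k - 1) <= x * (INR k * x ^ k * (x - 1)))
    by (apply Rmult_le_compat_l; lra).
  assert (1 <= x * x ^ k) by nra.
  assert (1 * (x - 1) <= x * x ^ k * (x - 1))
    by (apply Rmult_le_compat_r; lra).
  lra.
Qed.

Lemma phi_set_bounded (m : nat) (v : R) :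
  phi_set m v -> v <= INR m * INR m ^ m.
Proof.
intros [x [[H1 H2] ->]].
assert (Hpow : Rpower x (INR m - x) <= x ^ m).
{ rewrite <- Rpower_pow by lra. apply Rle_Rpower; lra. }
pose proof (pow_sub1_le x m H1) as Hk.
assert (Hm : x ^ m <= INR m ^ m) by (apply pow_incr; lra).
apply Rle_div_l; [lra |].
apply Rle_trans with (INR m * x ^ m * (x - 1)); [lra |].
apply Rmult_le_compat_r; [lra |].
apply Rmult_le_compat_l; lra.
Qed.

Lemma phi_is_lub (m : nat) : (2 <= m)%nat -> is_lub (phi_set m) (phi m).
Proof.
intros Hm.
assert (HmR : 2 <= INR m) by (apply (le_INR 2 m); exact Hm).
destruct (completeness (phi_set m)) as [l Hl].
- exists (INR m * INR m ^ m). intros v. apply phi_set_bounded.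
- eexists. exists (3 / 2). split; [lra | reflexivity].
- unfold phi.
  replace (Lub_Rbar (phi_set m)) with (Finite l); [exact Hl |].
  symmetry. apply is_lub_Rbar_unique. split.
  + intros v Hv. now apply (proj1 Hl).
  + intros [b | |] Hb; simpl.
    * apply (proj2 Hl). intros v Hv. apply (Hb v Hv).
    * exact I.
    * refine (Hb _ (ex_intro _ (3 / 2) (conj _ eq_refl))). lra.
Qed.

(* Main.v *)
Require Import Defs.
From Stdlib Require Import Reals Lra Lia.
From Coquelicot Require Import Coquelicot.
Open Scope R_scope.

(** Put [w = W(ne)] and [x0 = n/w], so that [ln x0 = w - 1].  Up to the factor
    [1 - x^-(n+1-x)], the logarithm of the function defining [phi (n+1)] is
    [g x - ln (1 - 1/x)] with [g x = (n - x) ln x], and [x0] is exactly the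
    maximiser of [g], with [g x0 = nw - 2n + n/w].  Evaluating at [x0] gives the
    lower bound, because [- ln (1 - 1/x0) >= w/n + 1/(2 x0^2)] and the neglected
    factor is far closer to 1.  For the upper bound,
    [g x <= g x0 - n (1 - x/x0)^2 / 2] for [x <= x0]: either [x] is so large that
    [1/(x-1) <= (w + 3/2)/n], with [3/2 < ln (ln (ne))], or this loss exceeds
    what remains, namely [1/(x-1)] if [x >= 2] and [1 + ln n] if [x < 2]. *)

(** * Elementary bounds for the logarithm and the exponential *)

(** The left side minus the right side vanishes at 0 and has derivative [- t ^ 2 / (1 - t)], which
    is nonpositive. *)
Lemma ln_one_minus_le (t : R) : 0 <= t < 1 -> ln (1 - t) <= - t - t ^ 2 / 2.
Proof.
intros Ht.
destruct (MVT_gen (fun t => ln (1 - t) + t + t ^ 2 / 2) 0 t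
            (fun t => - t ^ 2 / (1 - t))) as [c [Hc Heq]].
- intros x Hx. rewrite Rmin_left, Rmax_right in Hx by lra.
  auto_derive; [lra | field; lra].
- intros x Hx. rewrite Rmin_left, Rmax_right in Hx by lra.
  apply continuity_pt_filterlim.
  apply (ex_derive_continuous (fun t => ln (1 - t) + t + t ^ 2 / 2)).
  auto_derive. lra.
- rewrite Rmin_left, Rmax_right in Hc by lra.
  replace (1 - 0) with 1 in Heq by ring. rewrite ln_1 in Heq.
  assert (0 <= c ^ 2 / (1 - c)).
  { apply Rdiv_le_0_compat; [apply pow2_ge_0 | lra]. }
  assert (0 <= c ^ 2 / (1 - c) * t) by (apply Rmult_le_pos; lra).
  replace (- c ^ 2 / (1 - c)) with (- (c ^ 2 / (1 - c))) in Heq by (field; lra).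
  lra.
Qed.

Lemma ln_le_sub1 (x : R) : 0 < x -> ln x <= x - 1.
Proof.
intros Hx. pose proof (exp_ineq1_le (ln x)). rewrite exp_ln in H by exact Hx. lra.
Qed.

Lemma exp_le (x y : R) : x <= y -> exp x <= exp y.
Proof.
intros [H | ->]; [left; now apply exp_increasing | right; reflexivity].
Qed.

Lemma exp_INR_mult (k : nat) (x : R) : exp (INR k * x) = exp x ^ k.
Proof.
induction k as [| k IH].
- simpl. now rewrite Rmult_0_l, exp_0.
- rewrite S_INR, Rmult_plus_distr_r, Rmult_1_l, exp_plus, IH. simpl. ring.
Qed.

(** With [x] equal to 1/40 or -1/40, numerical bounds on [exp] reduce to rational arithmetic; the
    negative sign gives upper bounds through the reciprocal. *)
Lemma exp_ge_pow (k : nat) (x : R) : 0 <= 1 + x -> (1 + x) ^ k <= exp (INR k * x).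
Proof.
intros Hx. rewrite exp_INR_mult. apply pow_incr.
pose proof (exp_ineq1_le x). lra.
Qed.

Lemma exp_13_5_ge : 13 <= exp (13 / 5).
Proof.
pose proof (exp_ge_pow 104 (1 / 40)) as H.
replace (INR 104 * (1 / 40)) with (13 / 5) in H by (simpl; field).
lra.
Qed.

Lemma exp_13_5_le : exp (13 / 5) <= 14.
Proof.
pose proof (exp_ge_pow 104 (- (1 / 40))) as H.
replace (INR 104 * - (1 / 40)) with (- (13 / 5)) in H by (simpl; field).
rewrite exp_Ropp in H. pose proof (exp_pos (13 / 5)).
rewrite <- (Rinv_inv (exp (13 / 5))), <- (Rinv_inv 14).
apply Rinv_le_contravar; lra.
Qed.

(** Here 23/5 = 18/5 + 1 is the lower bound for [w + ln w] in the final estimate of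
    [ln (ln (ne))]. *)
Lemma exp_3_2_lt : exp (3 / 2) < 23 / 5.
Proof.
pose proof (exp_ge_pow 60 (- (1 / 40))) as H.
replace (INR 60 * - (1 / 40)) with (- (3 / 2)) in H by (simpl; field).
rewrite exp_Ropp in H. pose proof (exp_pos (3 / 2)).
rewrite <- (Rinv_inv (exp (3 / 2))), <- (Rinv_inv (23 / 5)).
apply Rinv_lt_contravar; [apply Rmult_lt_0_compat; [| apply Rinv_0_lt_compat]; lra | lra].
Qed.

(** * Size of the solution of [w * exp w = n * exp 1] *)

Lemma lambert_ln (n w : R) :
  0 < n -> 0 < w -> w * exp w = n * exp 1 -> w + ln w = 1 + ln n.
Proof.
intros Hn Hw H. apply (f_equal ln) in H.
rewrite !ln_mult, !ln_exp in H by (auto using exp_pos). lra.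
Qed.

Lemma lambert_exp (n w : R) : w * exp w = n * exp 1 -> n = w * exp (w - 1).
Proof.
intros H. unfold Rminus. rewrite exp_plus, exp_Ropp, <- Rmult_assoc, H.
field. apply Rgt_not_eq, exp_pos.
Qed.

(** If [w] were below 18/5, then [n = w * exp (w - 1)] would be less than 18/5 * 14 = 50.4. *)
Lemma lambert_ge (n w : R) :
  51 <= n -> 0 < w -> w * exp w = n * exp 1 -> 18 / 5 <= w.
Proof.
intros Hn Hw H. apply lambert_exp in H. apply Rnot_lt_le. intros Hlt.
assert (exp (w - 1) < exp (13 / 5)) by (apply exp_increasing; lra).
pose proof exp_13_5_le. pose proof (exp_pos (w - 1)). nra.
Qed.

(** Since [n = w * exp (w - 1)], it suffices that [w <= 28 / 100 * exp (w - 1)]. This follows from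
    [exp (w - 1) >= 13 * (1 + (w - 18 / 5))], as 0.28 * 13 = 3.64 > 18/5. *)
Lemma lambert_sqr_le (n w : R) :
  51 <= n -> 0 < w -> w * exp w = n * exp 1 -> w ^ 2 <= 28 / 100 * n.
Proof.
intros Hn Hw H. pose proof (lambert_ge n w Hn Hw H) as Hw'.
apply lambert_exp in H. rewrite H.
replace (w - 1) with (13 / 5 + (w - 18 / 5)) by lra. rewrite exp_plus.
pose proof exp_13_5_ge. pose proof (exp_ineq1_le (w - 18 / 5)).
assert (13 * (1 + (w - 18 / 5)) <= exp (13 / 5) * exp (w - 18 / 5))
  by (apply Rmult_le_compat; lra).
nra.
Qed.

(** * The exponent [(n - x) * ln x] near its maximum *)

(** Writing [u = x w / n], the deficit is [(n/w) (w (u - 1 - ln u) + (u ln u - u + 1))]. *)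
Lemma peak_deficit (n w x : R) :
  0 < n -> 0 < w -> 0 < x -> ln (n / w) = w - 1 ->
  n * (x * w / n - 1 - ln (x * w / n))
    <= (n - n / w) * (w - 1) - (n - x) * ln x.
Proof.
intros Hn Hw Hx Hx0.
assert (Hu : 0 < x * w / n) by (apply Rdiv_lt_0_compat; nra).
set (u := x * w / n) in *.
assert (Ex : x = n / w * u) by (unfold u; field; lra).
assert (Hx0' : 0 < n / w) by (apply Rdiv_lt_0_compat; lra).
assert (El : ln x = (w - 1) + ln u) by (rewrite Ex, ln_mult; lra).
assert (Hul : 0 <= u * ln u - u + 1).
{ pose proof (ln_le_sub1 (/ u) (Rinv_0_lt_compat _ Hu)) as H.
  rewrite ln_Rinv in H by exact Hu.
  apply (Rmult_le_compat_l u) in H; [| lra].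
  replace (u * (/ u - 1)) with (1 - u) in H by (field; lra). lra. }
assert (E : (n - n / w) * (w - 1) - (n - x) * ln x
  = n * (u - 1 - ln u) + n / w * (u * ln u - u + 1)).
{ rewrite El, Ex. field. lra. }
rewrite E. pose proof (Rmult_le_pos _ _ (Rlt_le _ _ Hx0') Hul). lra.
Qed.

Lemma peak_max (n w x : R) :
  0 < n -> 0 < w -> 0 < x -> ln (n / w) = w - 1 ->
  (n - x) * ln x <= (n - n / w) * (w - 1).
Proof.
intros Hn Hw Hx Hx0. pose proof (peak_deficit n w x Hn Hw Hx Hx0) as H.
assert (Hu : 0 < x * w / n) by (apply Rdiv_lt_0_compat; nra).
pose proof (ln_le_sub1 _ Hu). nra.
Qed.

Lemma peak_quadratic (n w x : R) :
  0 < n -> 0 < w -> 0 < x -> x * w / n <= 1 -> ln (n / w) = w - 1 ->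
  (n - x) * ln x <= (n - n / w) * (w - 1) - n * (1 - x * w / n) ^ 2 / 2.
Proof.
intros Hn Hw Hx Hu1 Hx0. pose proof (peak_deficit n w x Hn Hw Hx Hx0) as H.
assert (Hu : 0 < x * w / n) by (apply Rdiv_lt_0_compat; nra).
set (u := x * w / n) in *.
pose proof (ln_one_minus_le (1 - u)) as Hl.
replace (1 - (1 - u)) with u in Hl by ring.
assert (n * ((1 - u) ^ 2 / 2) <= n * (u - 1 - ln u))
  by (apply Rmult_le_compat_l; lra).
lra.
Qed.

(** * Upper bounds for the function under the supremum *)

(** The [- 1] is dropped, and the remaining factor is x/(x-1) = 1 + 1/(x-1) <= exp (1/(x-1)). *)
Lemma phi_term_le_large (n x : R) :
  2 <= x ->
  (Rpower x (n + 1 - x) - 1) / (x - 1) <= exp ((n - x) * ln x + 1 / (x - 1)).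
Proof.
intros Hx.
apply Rle_div_l; [lra |].
assert (Hp : Rpower x (n + 1 - x) = exp ((n - x) * ln x) * x).
{ unfold Rpower. replace ((n + 1 - x) * ln x) with ((n - x) * ln x + ln x) by ring.
  rewrite exp_plus, exp_ln by lra. reflexivity. }
rewrite Hp, exp_plus. pose proof (exp_pos ((n - x) * ln x)) as Hg.
assert (x <= exp (1 / (x - 1)) * (x - 1)).
{ apply Rle_trans with ((1 + 1 / (x - 1)) * (x - 1)).
  - right. field. lra.
  - apply Rmult_le_compat_r; [lra | apply exp_ineq1_le]. }
nra.
Qed.

(** Near 1 the factor x/(x-1) is unbounded, so the [- 1] must be kept: e^a - 1 <= a e^a with a =
    (n+1-x) ln x <= n (x-1), which cancels the denominator. The leftover factor x <= e accounts for
    the summand 1. *)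
Lemma phi_term_le_small (n x : R) :
  1 < x < 2 -> 2 <= n ->
  (Rpower x (n + 1 - x) - 1) / (x - 1) <= exp ((n - x) * ln x + (1 + ln n)).
Proof.
intros Hx Hn.
apply Rle_div_l; [lra |].
assert (0 < ln x) by (rewrite <- ln_1; apply ln_increasing; lra).
pose proof (ln_le_sub1 x ltac:(lra)) as Hlx.
assert (Hp : Rpower x (n + 1 - x) = exp ((n - x) * ln x + ln x)).
{ unfold Rpower. f_equal. ring. }
rewrite Hp, (Rplus_comm 1), <- Rplus_assoc, 2!exp_plus, exp_ln by lra.
assert (He : exp ((n - x) * ln x + ln x) - 1
  <= exp ((n - x) * ln x + ln x) * ((n - x) * ln x + ln x)).
{ set (a := (n - x) * ln x + ln x). pose proof (exp_ineq1_le (- a)) as H0.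
  rewrite exp_Ropp in H0. pose proof (exp_pos a) as H1.
  apply (Rmult_le_compat_l (exp a)) in H0; [| lra].
  rewrite Rinv_r in H0 by lra. lra. }
rewrite exp_plus, exp_ln in He |- * by lra.
apply Rle_trans with (1 := He).
pose proof (exp_pos ((n - x) * ln x)) as Hg.
pose proof (exp_ineq1_le 1).
assert (x <= exp 1) by lra.
rewrite !Rmult_assoc. apply Rmult_le_compat_l; [lra |].
apply Rle_trans with (exp 1 * (n * (x - 1))); [| right; ring].
assert (0 <= (n - x) * ln x) by (apply Rmult_le_pos; lra).
apply Rmult_le_compat; [lra | lra | lra |].
nra.
Qed.

Lemma phi_term_le (n w x : R) :
  51 <= n -> 0 < w -> w * exp w = n * exp 1 -> 1 < x < n + 1 ->
  (Rpower x (n + 1 - x) - 1) / (x - 1)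
    <= exp ((n - n / w) * (w - 1) + (w + 3 / 2) / n).
Proof.
intros Hn Hw HW Hx.
pose proof (lambert_ge n w Hn Hw HW) as Hw'.
pose proof (lambert_sqr_le n w Hn Hw HW) as Hw2.
pose proof (lambert_ln n w ltac:(lra) Hw HW) as Hln.
assert (Hx0 : ln (n / w) = w - 1) by (rewrite ln_div; lra).
assert (Hs0 : 0 < sqrt n) by (apply sqrt_lt_R0; lra).
assert (Hs : sqrt n * sqrt n = n) by (apply sqrt_sqrt; lra).
assert (Hq : 0 < (w + 3 / 2) / n) by (apply Rdiv_lt_0_compat; lra).
set (s := sqrt n) in *.
assert (Hs7 : 7 < s) by nra.
(* From [w ^ 2 <= 28 / 100 * n], because 0.53^2 = 0.2809. All later comparisons are made in terms of
   [s]. *)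
assert (Hws : w <= 53 / 100 * s) by nra.
destruct (Rlt_or_le x 2) as [H2 | H2].
- eapply Rle_trans; [apply phi_term_le_small; lra |].
  apply exp_le.
  assert (Hu : s * (x * w / n) <= 106 / 100).
  { replace (s * (x * w / n)) with (x * w / s) by (rewrite <- Hs; field; lra).
    apply Rle_div_l; [lra | nra]. }
  set (u := x * w / n) in *.
  assert (Hu1 : u <= 1) by nra.
  pose proof (peak_quadratic n w x ltac:(lra) Hw ltac:(lra) Hu1 Hx0) as H.
  fold u in H.
  assert (Hgain : (s - 106 / 100) ^ 2 <= n * (1 - u) ^ 2).
  { rewrite <- Hs. replace (s * s * (1 - u) ^ 2) with ((s - s * u) ^ 2) by ring.
    apply pow_incr. lra. }
  (* Now 1 + ln n = w + ln w <= 2w - 1 <= 1.06 s - 1, which is below the loss (s - 1.06)^2 / 2 for s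
     > 7. *)
  pose proof (ln_le_sub1 w Hw).
  nra.
- eapply Rle_trans; [apply phi_term_le_large; lra |].
  apply exp_le.
  destruct (Rle_or_lt (1 / (x - 1)) ((w + 3 / 2) / n)) as [Hc | Hc].
  + pose proof (peak_max n w x ltac:(lra) Hw ltac:(lra) Hx0). lra.
  + assert (Hx1 : (x - 1) * (w + 3 / 2) < n).
    { apply Rlt_div_r in Hc; [| lra].
      replace ((w + 3 / 2) / n * (x - 1)) with ((x - 1) * (w + 3 / 2) / n) in Hc
        by (field; lra).
      apply Rlt_div_l in Hc; lra. }
    (* The constant 1.42 exceeds the square root of 2, so the quadratic loss is at least 1 >=
       1/(x-1). It is 1.95 - 0.53, where 0.53 pays for replacing x by x - 1. *)
    assert (Hu : 142 / 100 <= s * (1 - x * w / n)).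
    { assert (Ha : s * (x * w / n) = w / s + (x - 1) * w / s)
        by (rewrite <- Hs; field; lra).
      assert (Hb : w / s <= 53 / 100) by (apply Rle_div_l; lra).
      (* By [Hx1], n - (x-1) w is at least (3/2) n / (w + 3/2), and [He] bounds this below by 1.95
         s. *)
      assert (Hd : 195 / 100 <= s - (x - 1) * w / s).
      { replace (s - (x - 1) * w / s) with ((n - (x - 1) * w) / s)
          by (rewrite <- Hs; field; lra).
        apply (Rle_div_r (195 / 100)); [lra |].
        assert (He : 195 / 100 * s * (w + 3 / 2) <= 3 / 2 * n).
        { rewrite <- Hs.
          assert (s * (195 / 100 * (w + 3 / 2)) <= s * (3 / 2 * s))
            by (apply Rmult_le_compat_l; lra).
          lra. }
        assert (w * ((x - 1) * (w + 3 / 2)) <= w * n)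
          by (apply Rmult_le_compat_l; lra).
        apply Rmult_le_reg_r with (w + 3 / 2); [lra |]. lra. }
      lra. }
    set (u := x * w / n) in *.
    assert (Hu1 : u <= 1) by nra.
    pose proof (peak_quadratic n w x ltac:(lra) Hw ltac:(lra) Hu1 Hx0) as H.
    fold u in H.
    assert (Hgain : 2 <= n * (1 - u) ^ 2).
    { rewrite <- Hs. replace (s * s * (1 - u) ^ 2) with ((s * (1 - u)) ^ 2) by ring.
      apply Rle_trans with ((142 / 100) ^ 2); [lra | apply pow_incr; lra]. }
    assert (1 / (x - 1) <= 1) by (apply Rle_div_l; lra).
    lra.
Qed.

(** * Lower bound at the maximiser *)

(** With G = exp ((n-x) ln x) and t = 1/x, the claim is G (x - (x-1) e^t) > 1. The bracket is at
    least x/(2x^2+1) and G >= x^2, so the product is at least x^3/(2x^2+1), which exceeds 1 for x >=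
    3. *)
Lemma phi_term_peak_gt (n x : R) :
  3 <= x -> 2 <= n - x ->
  exp ((n - x) * ln x + 1 / x) < (Rpower x (n + 1 - x) - 1) / (x - 1).
Proof.
intros Hx Hn.
assert (Hp : Rpower x (n + 1 - x) = exp ((n - x) * ln x) * x).
{ unfold Rpower. replace ((n + 1 - x) * ln x) with ((n - x) * ln x + ln x) by ring.
  rewrite exp_plus, exp_ln by lra. reflexivity. }
rewrite Hp, exp_plus.
assert (Hix : 0 < 1 / x <= 1 / 3).
{ split; [apply Rdiv_lt_0_compat; lra | apply Rle_div_l; lra]. }
assert (HG : x ^ 2 <= exp ((n - x) * ln x)).
{ rewrite <- (Rpower_pow 2) by lra. apply (Rle_Rpower x (INR 2) (n - x)); simpl; lra. }
set (G := exp ((n - x) * ln x)) in *.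
pose proof (ln_one_minus_le (1 / x) ltac:(lra)) as Hl.
set (t := 1 / x) in *.
assert (Hxt : x * t = 1) by (unfold t; field; lra).
(* The second-order term of ln (1 - t) supplies the slack that absorbs the subtracted 1. *)
assert (Ha : (1 - t) * exp t * (1 + t ^ 2 / 2) <= 1).
{ apply Rle_trans with ((1 - t) * exp t * exp (t ^ 2 / 2)).
  - apply Rmult_le_compat_l; [| apply exp_ineq1_le].
    apply Rmult_le_pos; [lra | left; apply exp_pos].
  - apply Rle_trans with (exp (ln (1 - t) + t + t ^ 2 / 2)).
    + rewrite 2!exp_plus, exp_ln by lra. lra.
    + apply Rle_trans with (exp 0); [apply exp_le | rewrite exp_0]; lra. }
assert (Hb : (x - 1) * exp t * (2 * x ^ 2 + 1) <= 2 * x ^ 3).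
{ replace ((x - 1) * exp t * (2 * x ^ 2 + 1))
    with (2 * x ^ 3 * ((1 - t) * exp t * (1 + t ^ 2 / 2)))
    by (unfold t; field; lra).
  assert (0 <= 2 * x ^ 3) by (assert (0 < x ^ 3) by (apply pow_lt; lra); lra).
  nra. }
apply (Rlt_div_r (G * exp t)); [lra |].
assert (Hc : x <= (x - (x - 1) * exp t) * (2 * x ^ 2 + 1)) by lra.
assert (Hd : 0 <= x - (x - 1) * exp t) by nra.
assert (He : 1 < x ^ 2 * (x - (x - 1) * exp t)).
{ apply Rmult_lt_reg_r with (2 * x ^ 2 + 1); [nra |].
  apply Rlt_le_trans with (x ^ 2 * x); [nra |].
  rewrite Rmult_assoc. apply Rmult_le_compat_l; [nra | lra]. }
assert (x ^ 2 * (x - (x - 1) * exp t) <= G * (x - (x - 1) * exp t))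
  by (apply Rmult_le_compat_r; lra).
lra.
Qed.

Theorem theorem1p12 (n : nat) (hn : (51 <= n)%nat) :
  INR n * LambertW (INR n * exp 1) - 2 * INR n
    + INR n / LambertW (INR n * exp 1)
    + LambertW (INR n * exp 1) / INR n
  < ln (phi (n + 1))
  < INR n * LambertW (INR n * exp 1) - 2 * INR n
    + INR n / LambertW (INR n * exp 1)
    + LambertW (INR n * exp 1) / INR n
    + ln (ln (INR n * exp 1)) / INR n.
Proof.
assert (Hn : 51 <= INR n).
{ apply le_INR in hn. simpl in hn. lra. }
destruct (phi_is_lub (n + 1) ltac:(lia)) as [Hub Hlub].
unfold phi_set, is_upper_bound in Hub, Hlub.
rewrite plus_INR in Hub, Hlub. change (INR 1) with 1 in Hub, Hlub.
destruct (LambertW_spec (INR n * exp 1)) as [Hw HW].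
{ pose proof (exp_pos 1). nra. }
set (w := LambertW (INR n * exp 1)) in *. set (N := INR n) in *.
pose proof (lambert_ge N w Hn Hw HW) as Hw'.
pose proof (lambert_ln N w ltac:(lra) Hw HW) as Hln.
assert (Hx0 : ln (N / w) = w - 1) by (rewrite ln_div; lra).
assert (Hpeak : N * w - 2 * N + N / w = (N - N / w) * (w - 1)) by (field; lra).
assert (Hlow : exp ((N - N / w) * (w - 1) + w / N) < phi (n + 1)).
{ assert (H3 : 3 <= N / w).
  { rewrite <- (exp_ln (N / w)) by (apply Rdiv_lt_0_compat; lra).
    rewrite Hx0. pose proof (exp_ineq1_le (w - 1)). lra. }
  assert (H2 : N / w <= N / 2).
  { unfold Rdiv. apply Rmult_le_compat_l; [lra |]. apply Rinv_le_contravar; lra. }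
  pose proof (phi_term_peak_gt N (N / w) H3 ltac:(lra)) as H.
  rewrite Hx0 in H. replace (1 / (N / w)) with (w / N) in H by (field; lra).
  eapply Rlt_le_trans; [exact H |].
  apply Hub. exists (N / w). split; [lra | reflexivity]. }
assert (Hupp : phi (n + 1) <= exp ((N - N / w) * (w - 1) + (w + 3 / 2) / N)).
{ apply Hlub. intros v [x [Hx ->]]. now apply phi_term_le. }
(* Here ln (Ne) = 1 + ln N = w + ln w, and w >= 18/5 > e gives ln w >= 1, hence a value of at least
   23/5. *)
assert (HL : 3 / 2 < ln (ln (N * exp 1))).
{ rewrite ln_mult, ln_exp by (auto using exp_pos; lra).
  assert (1 <= ln w).
  { rewrite <- (ln_exp 1). apply ln_le; [apply exp_pos |].
    pose proof exp_le_3. lra. }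
  rewrite <- (ln_exp (3 / 2)). apply ln_increasing; [apply exp_pos |].
  pose proof exp_3_2_lt. lra. }
rewrite Hpeak. split.
- rewrite <- (ln_exp ((N - N / w) * (w - 1) + w / N)).
  apply ln_increasing; [apply exp_pos | exact Hlow].
- apply Rle_lt_trans with ((N - N / w) * (w - 1) + (w + 3 / 2) / N).
  + rewrite <- (ln_exp ((N - N / w) * (w - 1) + (w + 3 / 2) / N)).
    apply ln_le; [| exact Hupp].
    (* Positivity of [phi (n + 1)], needed to take logarithms, comes from the lower bound. *)
    eapply Rlt_trans; [apply exp_pos | exact Hlow].
  + replace ((w + 3 / 2) / N) with (w / N + (3 / 2) / N) by (field; lra).
    assert (3 / 2 / N < ln (ln (N * exp 1)) / N)
      by (apply Rmult_lt_compat_r; [apply Rinv_0_lt_compat |]; lra).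
    lra.
Qed.
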